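(* Let $p$ be a prime and let $n,m,s,j$ be integers with $n\ge m\ge 1$ and $s>j\ge 0$. Then \[ E(n\times m,p^s,p^j)=\Bigl(\prod_{u=n-m+2}^{n}\varphi_u(p^s)\Bigr)\,\varphi_{n-m+1}(p^{s-j})\;p^{\,s\frac{m(m-1)}{2}-j(m-1)}\binom{m+j-1}{j}_p, \] where the product is empty (equal to $1$) when $m=1$.
   Context: $\mathbb{Z}_{p^s}$ denotes the ring of integers modulo $p^s$. $E(n\times m,p^s,p^j)$ is the number of $n\times m$ matrices $A$ with entries in $\mathbb{Z}_{p^s}$ such that the homogeneous system $Ax\equiv 0\pmod{p^s}$ has exactly $p^j$ solutions $x\in\mathbb{Z}_{p^s}^m$ (i.e. $|\ker A|=p^j$ for $A:\mathbb{Z}_{p^s}^m\to\mathbb{Z}_{p^s}^n$). For positive integers $u,c$, $\varphi_u(c)$ is the number of $u$-tuples $(a_1,\dots,a_u)$ with $1\le a_i\le c$ such that at least one $a_i$ is relatively prime to $c$ (so $\varphi_u(p^t)=p^{u(t-1)}(p^u-1)$ for $t\ge1$ and $\varphi_u(1)=1$). The Gaussian binomial coefficient is $\binom{N}{k}_q=\frac{(1-q^N)(1-q^{N-1})\cdots(1-q^{N-k+1})}{(1-q)(1-q^2)\cdots(1-q^k)}$ for integers $1\le k\le N$, $\binom{N}{0}_q=1$, and $\binom{N}{k}_q=0$ for $k>N$. *)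

(* Defs.v *)
From mathcomp Require Import all_boot all_order all_algebra.

Set Implicit Arguments.
Unset Strict Implicit.
Unset Printing Implicit Defensive.

Import GRing.Theory.

Local Open Scope ring_scope.

(* 'Z_N is the ring of integers modulo N only for N > 1. *)
Definition num_sol (n m N : nat) (A : 'M['Z_N]_(n, m)) : nat :=
  #|[set x : 'cV['Z_N]_m | A *m x == 0]|.

Definition E (n m N k : nat) : nat :=
  #|[set A : 'M['Z_N]_(n, m) | num_sol A == k]|.

Definition phi (u c : nat) : nat :=
  #|[set a : u.-tuple 'I_c.+1 |
      [forall i : 'I_u, (1 <= tnth a i)%N] &&
      [exists i : 'I_u, coprime (tnth a i) c]]|.

(* For k = 0 both products are empty; for k > N the numerator contains the
   factor 1 - q ^+ (N - N) = 0.  The denominator is nonzero for q > 1. *)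
Definition gauss_binom (q N k : nat) : rat :=
  (\prod_(0 <= i < k) (1 - q%:R ^+ (N - i))) /
  (\prod_(1 <= i < k.+1) (1 - q%:R ^+ i)).

(* Main.v *)
(* Write R = Z/p^s and sort the matrices by their first column a.
   If a has a unit entry, row operations turn it into the first basis vector, and
   the kernel size is that of the lower right (n-1) x (m-1) block.  Otherwise
   a = p a', and as long as the kernel is smaller than R, replacing a by a'
   divides its size by p; each a arises from p^n vectors a'.  Hence, for j < s,
   p^n N(n,m,p^j) = p^n phi_n(p^s) |R|^(m-1) N(n-1,m-1,p^j) + N(n,m,p^(j-1)),
   which is q-Pascal's rule for binom(m+j-1, j)_p up to normalisation. *)
Require Import Defs.
From mathcomp Require Import all_boot all_order all_fingroup all_algebra ring.

Set Implicit Arguments.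
Unset Strict Implicit.
Unset Printing Implicit Defensive.

Import GRing.Theory Num.Theory.

Local Open Scope ring_scope.

(** * Kernel sizes over a finite commutative ring *)

Section KernelCount.

Variable R : finComUnitRingType.

Definition unimodular n (a : 'cV[R]_n) : bool :=
  [exists i, a i ord0 \is a GRing.unit].

Definition kernel_size n m (A : 'M[R]_(n, m)) : nat :=
  #|[set x : 'cV[R]_m | A *m x == 0]|.

Definition kernel_count n m k : nat :=
  #|[set A : 'M[R]_(n, m) | kernel_size A == k]|.

Lemma card_sum_bool (T : finType) (P : pred T) :
  #|[set x | P x]| = (\sum_x P x)%N.
Proof. by rewrite -sum1_card big_mkcond; apply: eq_bigr => x _; rewrite inE. Qed.

Lemma sum_row_mx n m1 m2 (F : 'M[R]_(n, m1 + m2) -> nat) :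
  (\sum_A F A = \sum_a \sum_b F (row_mx a b))%N.
Proof.
rewrite pair_bigA /=.
rewrite (reindex (fun u : 'M_(n, m1) * 'M_(n, m2) => row_mx u.1 u.2)) //.
exists (fun A => (lsubmx A, rsubmx A)) => [[a b] _ | A _] /=.
  by rewrite row_mxKl row_mxKr.
by rewrite hsubmxK.
Qed.

Lemma sum_col_mx n1 n2 m (F : 'M[R]_(n1 + n2, m) -> nat) :
  (\sum_A F A = \sum_a \sum_b F (col_mx a b))%N.
Proof.
rewrite pair_bigA /=.
rewrite (reindex (fun u : 'M_(n1, m) * 'M_(n2, m) => col_mx u.1 u.2)) //.
exists (fun A => (usubmx A, dsubmx A)) => [[a b] _ | A _] /=.
  by rewrite col_mxKu col_mxKd.
by rewrite vsubmxK.
Qed.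

Lemma kernel_size_col n m1 m2 (A : 'M[R]_(n, m1)) (B : 'M[R]_(n, m2)) :
  kernel_size (row_mx A B) =
  (\sum_(y : 'cV_m2) \sum_(x : 'cV_m1) (A *m x + B *m y == 0)%R)%N.
Proof.
rewrite /kernel_size card_sum_bool sum_col_mx exchange_big /=.
by apply: eq_bigr => y _; apply: eq_bigr => x _; rewrite mul_row_col.
Qed.

Lemma kernel_size_mull n m (H : 'M[R]_n) (A : 'M[R]_(n, m)) :
  H \in unitmx -> kernel_size (H *m A) = kernel_size A.
Proof.
move=> uH; apply: eq_card => x; rewrite !inE -mulmxA.
apply/eqP/eqP => [/(congr1 (mulmx (invmx H))) | ->]; last by rewrite mulmx0.
by rewrite mulKmx // mulmx0.
Qed.

(** Swap the unit entry to the top; the swapped column is then the first column of a lower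
    triangular [L] whose determinant is that unit. *)
Lemma unimodular_unitmx n (a : 'cV[R]_(1 + n)) : unimodular a ->
  exists2 H : 'M[R]_(1 + n), H \in unitmx & a = H *m col_mx 1%:M 0.
Proof.
case/existsP=> i ui; pose b : 'cV[R]_(1 + n) := xrow ord0 i a.
pose L : 'M[R]_(1 + n) := block_mx (usubmx b) 0 (dsubmx b) 1%:M.
have uL : L \in unitmx.
  rewrite unitmxE /L det_lblock det1 mulr1 det_mx11 !mxE.
  have -> : lshift n (0 : 'I_1) = ord0 by apply: ord_inj.
  by rewrite tpermL.
exists (tperm_mx ord0 i *m L); first by rewrite unitmx_mul unitmx_perm.
have Lb : L *m col_mx 1%:M 0 = b.
  by rewrite /L mul_block_col !mulmx0 !mulmx1 !addr0 vsubmxK.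
by rewrite -mulmxA Lb /b xrowE mulmxA -perm_mxM tperm2 perm_mx1 mul1mx.
Qed.

(** The first row forces the first coordinate to be [- (b *m y)], so the kernel is a graph over the
    kernel of [A]. *)
Lemma kernel_size_unitcol n m (b : 'rV[R]_m) (A : 'M[R]_(n, m)) :
  kernel_size (row_mx (col_mx (1%:M : 'M_1) 0) (col_mx b A)) = kernel_size A.
Proof.
rewrite kernel_size_col [RHS]card_sum_bool; apply: eq_bigr => y _.
rewrite (bigD1 (- (b *m y))) //= big1 => [|x nx].
  rewrite !mul_col_mx mul1mx mul0mx add_col_mx addNr add0r addn0.
  by rewrite -{1}(col_mx0 R 1 n 1); congr nat_of_bool; apply/eqP/eqP=> [/eq_col_mx[]|->].
rewrite !mul_col_mx mul1mx mul0mx add_col_mx add0r.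
case: eqP => //; rewrite -(col_mx0 R 1 n 1) => /eq_col_mx[/eqP].
by rewrite addr_eq0 (negPf nx).
Qed.

(** Substituting [H *m B] for [B] reduces to the first basis vector; the top row of [B] is then
    free, which gives [#|R| ^ m]. *)
Lemma count_unimodular_col n m k (a : 'cV[R]_(1 + n)) : unimodular a ->
  (\sum_(B : 'M_(1 + n, m)) (kernel_size (row_mx a B) == k) =
   #|R| ^ m * kernel_count n m k)%N.
Proof.
case/unimodular_unitmx=> H uH ->.
rewrite (reindex (mulmx H)) /=; last first.
  exists (mulmx (invmx H)) => B _; [exact: mulKmx | exact: mulKVmx].
under eq_bigr do rewrite -mul_mx_row kernel_size_mull //.
rewrite sum_col_mx.
under eq_bigr do under eq_bigr do rewrite kernel_size_unitcol.
by rewrite sum_nat_const card_mx mul1n -card_sum_bool.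
Qed.

(** * Scaling by a generator of the maximal ideal *)

Variables (pi : R) (p : nat).
Hypothesis p_gt1 : (1 < p)%N.
(** Abstracts the class of p in Z/p^s: the multiples of [pi] are exactly the non-units, and all
    nonempty fibres have [p] elements. *)
Hypothesis card_mul_pi : forall c : R,
  #|[set x | pi * x == c]| = if c \is a GRing.unit then 0%N else p.

Lemma card_scale_pi n (c : 'cV[R]_n) :
  #|[set a | pi *: a == c]| = if unimodular c then 0%N else (p ^ n)%N.
Proof.
transitivity (\prod_(i < n) #|[set x | (pi * x == c i ord0)%R]|)%N.
  rewrite -cardsXn -(card_imset _ (f := fun a : 'cV_n => [ffun i => a i ord0])).
    apply: eq_card => f; apply/imsetP/setXnP => [[a]|fc].
      rewrite inE => /eqP ac -> i; by rewrite inE ffunE -ac mxE.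
    exists (\col_i f i); last by apply/ffunP => i; rewrite ffunE mxE.
    rewrite inE; apply/eqP/matrixP => i k; rewrite ord1 !mxE.
    by have := fc i; rewrite inE => /eqP.
  move=> a b /ffunP eq_ab; apply/matrixP => i k.
  by rewrite ord1; have := eq_ab i; rewrite !ffunE.
case: ifP => [/existsP[i ui] | /existsPn nu].
  by rewrite (bigD1 i) //= card_mul_pi ui.
under eq_bigr => i _ do rewrite card_mul_pi (negPf (nu i)).
by rewrite prod_nat_const card_ord.
Qed.

Lemma sum_scale_pi n (G : 'cV[R]_n -> nat) :
  (\sum_a G (pi *: a) = p ^ n * \sum_(a | ~~ unimodular a) G a)%N.
Proof.
rewrite (partition_big (fun a => pi *: a) predT) //= big_distrr /=.
rewrite [RHS]big_mkcond; apply: eq_bigr => c _ /=.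
transitivity (\sum_(a in [set a | pi *: a == c]) G c)%N.
  by apply: eq_big => [a | a /eqP -> //]; rewrite inE.
by rewrite sum_nat_const card_scale_pi; case: unimodular.
Qed.

(** Summing the constant 1 in [sum_scale_pi] counts the complement, which is a fraction 1/p^n of all
    columns. *)
Lemma card_unimodular n :
  (p ^ n * #|[set a : 'cV[R]_n | unimodular a]| = (p ^ n).-1 * #|R| ^ n)%N.
Proof.
have E1 : (p ^ n * #|[set a : 'cV[R]_n | ~~ unimodular a]| = #|R| ^ n)%N.
  rewrite -sum1_card; under eq_bigl do rewrite inE.
  by rewrite -(sum_scale_pi (fun=> 1%N)) sum_nat_const card_mx !muln1.
have := cardC [set a : 'cV[R]_n | unimodular a].
rewrite card_mx muln1 => E2; rewrite -subn1 mulnBl mul1n -{2}E1 -E2 mulnDr.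
rewrite [X in (_ + p ^ n * X - _)%N](_ : _ = #|[set a : 'cV[R]_n | ~~ unimodular a]|).
  by rewrite addnK.
by apply: eq_card => a; rewrite !inE.
Qed.

(** The scalar moves from the column to the coordinate, (pi a) x = a (pi x), and pi x runs p times
    over the non-units. *)
Lemma kernel_size_scale n m (a : 'cV[R]_n) (B : 'M[R]_(n, m)) :
  kernel_size (row_mx (pi *: a) B) =
  (p * \sum_(y : 'cV_m) \sum_(x : 'cV_1 | ~~ unimodular x)
         (a *m x + B *m y == 0)%R)%N.
Proof.
rewrite kernel_size_col big_distrr /=; apply: eq_bigr => y _.
rewrite -{1}(expn1 p) -sum_scale_pi; apply: eq_bigr => x _.
by rewrite -scalemxAl scalemxAr.
Qed.

(** The multiples t (x, y) lie in the kernel and are pairwise distinct, because x is a unit. *)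
Lemma leq_card_kernel n m (a : 'cV[R]_n) (B : 'M[R]_(n, m)) (x : 'cV_1) (y : 'cV_m) :
  unimodular x -> a *m x + B *m y = 0 -> (#|R| <= kernel_size (row_mx a B))%N.
Proof.
case/existsP=> i ux xy0.
have inj : injective (fun t : R => t *: col_mx x y).
  move=> t u /matrixP/(_ (lshift m i) ord0).
  by rewrite mxE [RHS]mxE col_mxEu => /(mulIr ux).
rewrite -(card_codom inj); apply/subset_leq_card/subsetP => _ /codomP[t ->].
by rewrite inE -scalemxAr mul_row_col xy0 scaler0.
Qed.

(** A kernel vector with unit first coordinate makes both kernels too large, so both sides are
    false. Without one, the restricted sum in [kernel_size_scale] is the whole kernel of
    [row_mx a B]. *)
Lemma kernel_size_scale_eq n m k (a : 'cV[R]_n) (B : 'M[R]_(n, m)) :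
  (p * k < #|R|)%N ->
  (kernel_size (row_mx (pi *: a) B) == p * k)%N = (kernel_size (row_mx a B) == k).
Proof.
move=> ltk.
case: (boolP [exists x : 'cV[R]_1, exists y : 'cV[R]_m,
  unimodular x && (a *m x + B *m y == 0)]).
  case/existsP=> x /existsP[y /andP[ux /eqP xy0]].
  have le1 := leq_card_kernel ux xy0.
  have le2 : (#|R| <= kernel_size (row_mx (pi *: a) B))%N.
    apply: (leq_card_kernel (y := pi *: y) ux).
    by rewrite -scalemxAl -scalemxAr -scalerDr xy0 scaler0.
  rewrite !gtn_eqF ?(leq_trans ltk) //; apply: leq_trans le1.
  by apply: leq_ltn_trans ltk; rewrite leq_pmull // ltnW.
move=> /existsPn nK; rewrite kernel_size_scale eqn_pmul2l ?(ltnW p_gt1) //.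
rewrite kernel_size_col; congr (_ == _); apply: eq_bigr => y _.
rewrite big_mkcond; apply: eq_bigr => x _; case: ifP => // /negbFE ux.
by have /existsPn/(_ y) := nK x; rewrite ux /= => /negPf ->.
Qed.

(** * Recursion on the first column *)

Lemma kernel_count_rec n m k :
  (p ^ n.+1 * kernel_count n.+1 m.+1 k =
   p ^ n.+1 * (#|[set a : 'cV[R]_n.+1 | unimodular a]| * #|R| ^ m * kernel_count n m k)
   + \sum_(a : 'cV_n.+1) \sum_(B : 'M_(n.+1, m)) 
       (kernel_size (row_mx (pi *: a) B) == k))%N.
Proof.
rewrite (sum_scale_pi (fun a => \sum_B (kernel_size (row_mx a B) == k))%N) -mulnDr.
congr muln; rewrite /kernel_count card_sum_bool (@sum_row_mx n.+1 1 m).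
rewrite (bigID (@unimodular n.+1)) /=; congr addn.
rewrite (eq_bigr _ (fun a ua => @count_unimodular_col n m k a ua)).
by rewrite sum_nat_const mulnA; congr (_ * _ * _)%N; apply: eq_card => a; rewrite !inE.
Qed.

(** A column pi a makes the kernel size a multiple of p, hence never 1. *)
Lemma kernel_count_rec1 n m :
  (kernel_count n.+1 m.+1 1 =
   #|[set a : 'cV[R]_n.+1 | unimodular a]| * #|R| ^ m * kernel_count n m 1)%N.
Proof.
have pn : (0 < p ^ n.+1)%N by rewrite expn_gt0 ltnW.
apply/eqP; rewrite -(eqn_pmul2l pn) kernel_count_rec; apply/eqP.
rewrite big1 ?addn0 // => a _; rewrite big1 // => B _.
by rewrite kernel_size_scale muln_eq1 gtn_eqF.
Qed.

Lemma kernel_count_recM n m k : (p * k < #|R|)%N ->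
  (p ^ n.+1 * kernel_count n.+1 m.+1 (p * k) =
   p ^ n.+1 * (#|[set a : 'cV[R]_n.+1 | unimodular a]| * #|R| ^ m
               * kernel_count n m (p * k))
   + kernel_count n.+1 m.+1 k)%N.
Proof.
move=> ltk; rewrite kernel_count_rec; congr addn.
rewrite /kernel_count card_sum_bool (@sum_row_mx n.+1 1 m).
by apply: eq_bigr => a _; apply: eq_bigr => B _; rewrite kernel_size_scale_eq.
Qed.

End KernelCount.

(** * The ring of integers modulo a prime power, and the totients *)

Lemma card_Zp_mul_prime p s (c : 'Z_(p ^ s.+1)) : prime p ->
  #|[set x : 'Z_(p ^ s.+1) | p%:R * x == c]| =
  if c \is a GRing.unit then 0%N else p.
Proof.
move=> p_pr; have p_gt0 := prime_gt0 p_pr.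
have N_gt1 : (1 < p ^ s.+1)%N by rewrite -(exp1n s.+1) ltn_exp2r ?prime_gt1.
have M_gt0 : (0 < p ^ s)%N by rewrite expn_gt0 p_gt0.
have ltN (x : 'Z_(p ^ s.+1)) : (x < p * p ^ s)%N.
  by rewrite -expnS -[X in (_ < X)%N](Zp_cast N_gt1).
have mulE (x : 'Z_(p ^ s.+1)) : (p%:R * x == c) = (p * (x %% p ^ s) == c)%N.
  rewrite -(inj_eq (@ord_inj _)) -[X in _ * X]natr_Zp -natrM val_Zp_nat //.
  by rewrite [X in (_ %% X)%N]expnS muln_modr.
under eq_finset do rewrite mulE.
rewrite -[X in X \is a _]natr_Zp unitZpE // coprime_pexpl // prime_coprime //.
case: dvdnP => [[d cE] | ndvd] /=; last first.
  apply/eqP; rewrite cards_eq0 -subset0; apply/subsetP => x.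
  by rewrite !inE => /eqP xc; case: ndvd; exists (x %% p ^ s)%N; rewrite mulnC.
have d_lt : (d < p ^ s)%N by rewrite -(ltn_pmul2l p_gt0) (mulnC p d) -cE.
(* For c = p d the equation only fixes x modulo p^s, so the solutions are the p lifts of d. *)
pose f (i : 'I_p) : 'Z_(p ^ s.+1) := (d + i * p ^ s)%:R.
have fE i : f i = (d + i * p ^ s)%N :> nat.
  rewrite val_Zp_nat // modn_small // expnS.
  apply: leq_trans (leq_mul (ltn_ord i) (leqnn _)).
  by rewrite mulSn ltn_add2r.
rewrite -[RHS]card_ord -(card_imset _ (f := f)); last first.
  move=> i k /(congr1 (@nat_of_ord _)); rewrite !fE => /addnI/eqP.
  by rewrite eqn_pmul2r // => /eqP/ord_inj.
apply: eq_card => x; rewrite inE cE mulnC eqn_pmul2r //.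
apply/eqP/imsetP => [xd | [i _ ->]]; last first.
  by rewrite fE addnC modnMDl modn_small.
have x_lt : (x %/ p ^ s < p)%N by rewrite ltn_divLR.
exists (Ordinal x_lt) => //; apply: ord_inj.
by rewrite fE /= -xd addnC -divn_eq.
Qed.

Lemma card_tuple_forall (T : finType) (P : pred T) u :
  #|[set a : u.-tuple T | [forall i, P (tnth a i)]]| = (#|[set x | P x]| ^ u)%N.
Proof.
rewrite -[X in (_ ^ X)%N]card_ord -card_ffun_on.
rewrite -(card_imset _ (f := fun a : u.-tuple T => [ffun i => tnth a i])).
  apply: eq_card => f; apply/imsetP/ffun_onP => [[a] | fP].
    by rewrite inE => /forallP aP -> i; rewrite inE ffunE.
  exists [tuple f i | i < u]; last by apply/ffunP => i; rewrite ffunE tnth_mktuple.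
  by rewrite inE; apply/forallP => i; rewrite tnth_mktuple; have := fP i; rewrite inE.
by move=> a b /ffunP ab; apply: eq_from_tnth => i; have := ab i; rewrite !ffunE.
Qed.

Lemma card_ord_dvdn d c :
  #|[set x : 'I_c.+1 | (1 <= x)%N && (d %| x)%N]| = (c %/ d)%N.
Proof.
rewrite card_sum_bool big_ord_recl add0n divn_count_dvd big_add1 big_mkord.
by apply: eq_bigr.
Qed.

(** The tuples missed by [phi] are those with every entry divisible by p, and p^t of the integers
    from 1 to p^(t+1) are. *)
Lemma phi_prime_power p u t : prime p ->
  (phi u (p ^ t.+1) + (p ^ t) ^ u = (p ^ t.+1) ^ u)%N.
Proof.
move=> p_pr; set c := (p ^ t.+1)%N.
(* With divisor 1, [card_ord_dvdn] also counts all the entries from 1 to c. *)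
have c1 : (c = c %/ 1)%N by rewrite divn1.
rewrite {2}c1 -(card_ord_dvdn 1) -card_tuple_forall.
have -> : (p ^ t = c %/ p)%N by rewrite /c expnS mulKn // prime_gt0.
rewrite -card_ord_dvdn -card_tuple_forall /phi.
rewrite -[RHS](cardsID [set a : u.-tuple 'I_c.+1 | [exists i, coprime (tnth a i) c]]).
congr addn; apply: eq_card => a; rewrite !inE.
  by congr andb; apply: eq_forallb => i; rewrite dvd1n andbT.
have ncoprime i : ~~ coprime (tnth a i) c = (p %| tnth a i)%N.
  by rewrite coprime_pexpr // coprime_sym prime_coprime // negbK.
rewrite negb_exists; apply/forallP/andP => [aP | [/forallP a2 /forallP a1] i].
  by split; apply/forallP => i; have /andP[a1 a2] := aP i; rewrite ?ncoprime ?a1 ?dvd1n.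
by rewrite -ncoprime a2 andbT; have /andP[] := a1 i.
Qed.

Lemma phi_natr p u t : prime p ->
  (phi u (p ^ t.+1))%:R = (1 - p%:R ^- u) * p%:R ^+ (t.+1 * u) :> rat.
Proof.
move=> p_pr; have p0 : p%:R != 0 :> rat by rewrite pnatr_eq0 -lt0n prime_gt0.
rewrite -[LHS](addrK ((p ^ t) ^ u)%:R) -natrD phi_prime_power // -!expnM !natrX.
by rewrite mulSn exprD; field; rewrite expf_neq0.
Qed.

(** Both numbers, multiplied by p^n, equal (p^n - 1) |R|^n. *)
Lemma card_unimodular_Zp p n s : prime p ->
  #|[set a : 'cV['Z_(p ^ s.+1)]_n | unimodular a]| = phi n (p ^ s.+1).
Proof.
move=> p_pr; have p_gt1 := prime_gt1 p_pr.
have pn_gt0 : (0 < p ^ n)%N by rewrite expn_gt0 ltnW.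
have N_gt1 : (1 < p ^ s.+1)%N by rewrite -(exp1n s.+1) ltn_exp2r.
apply/eqP; rewrite -(eqn_pmul2l pn_gt0).
rewrite (card_unimodular (fun c => card_Zp_mul_prime c p_pr)).
rewrite -(eqn_add2r (p ^ n * (p ^ s) ^ n)) -mulnDr phi_prime_power //.
rewrite card_ord Zp_cast // -[X in (_ + X)%N]expnMn -expnS.
by rewrite -[X in (_ + X)%N]mul1n -mulnDl addn1 prednK.
Qed.

Lemma kernel_count_cols0 (R : finComUnitRingType) n k :
  kernel_count R n 0 k = (k == 1%N).
Proof.
rewrite /kernel_count; case: eqP => [-> | nk].
  transitivity #|{: 'M[R]_(n, 0)}|; last by rewrite card_mx muln0.
  apply: eq_card => A; rewrite !inE /kernel_size.
  transitivity (#|{: 'cV[R]_0}| == 1)%N; last by rewrite card_mx.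
  by congr (_ == _); apply: eq_card => x; rewrite !inE [x]flatmx0 mulmx0 eqxx.
apply/eqP; rewrite cards_eq0 -subset0; apply/subsetP => A; rewrite !inE => /eqP Ak.
case: nk; rewrite -Ak /kernel_size.
transitivity #|{: 'cV[R]_0}|; last by rewrite card_mx.
by apply: eq_card => x; rewrite !inE [x]flatmx0 mulmx0 eqxx.
Qed.

(** * Gaussian binomials *)

Lemma gauss_binom0 q N : gauss_binom q N 0 = 1.
Proof. by rewrite /gauss_binom !big_geq // divr1. Qed.

Lemma gauss_binom_small q j : gauss_binom q j j.+1 = 0.
Proof. by rewrite /gauss_binom big_nat_recr //= subnn expr0 subrr mulr0 mul0r. Qed.

Lemma gauss_binom_pascal q m j : (1 < q)%N ->
  gauss_binom q (m + j).+1 j.+1 =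
  q%:R ^+ j.+1 * gauss_binom q (m + j) j.+1 + gauss_binom q (m + j) j.
Proof.
move=> q_gt1.
have nz i : (0 < i)%N -> 1 - q%:R ^+ i != 0 :> rat.
  move=> i_gt0; rewrite subr_eq0 eq_sym -natrX (eqr_nat _ _ 1).
  by rewrite gtn_eqF // -(exp1n i) ltn_exp2r.
have den : \prod_(1 <= i < j.+2) (1 - q%:R ^+ i) =
    \prod_(1 <= i < j.+1) (1 - q%:R ^+ i) * (1 - q%:R ^+ j.+1) :> rat.
  by rewrite big_nat_recr.
have num : \prod_(0 <= i < j.+1) (1 - q%:R ^+ (m + j - i)) =
    \prod_(0 <= i < j) (1 - q%:R ^+ (m + j - i)) * (1 - q%:R ^+ m) :> rat.
  by rewrite big_nat_recr //= addnK.
have num1 : \prod_(0 <= i < j.+1) (1 - q%:R ^+ ((m + j).+1 - i)) =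
    (1 - q%:R ^+ (m + j).+1) * \prod_(0 <= i < j) (1 - q%:R ^+ (m + j - i)) :> rat.
  by rewrite big_nat_recl.
rewrite /gauss_binom num1 num den.
have b0 : \prod_(1 <= i < j.+1) (1 - q%:R ^+ i) != 0 :> rat.
  rewrite prodf_seq_neq0; apply/allP => i.
  by rewrite mem_index_iota => /andP[/nz].
move: (\prod_(0 <= i < j) _) b0 => a; move: (\prod_(1 <= i < j.+1) _) => b b0.
have := nz j.+1 isT.
(* With the common products cancelled, the claim is 1 - x y = x (1 - y) + (1 - x). *)
rewrite -addnS exprD; move: (q%:R ^+ j.+1) (q%:R ^+ m) => x y x0.
by field; rewrite x0 b0.
Qed.

(** * Closed form of the count *)

(** The difference [d] of rows and columns is fixed, as the recursion removes one of each. Every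
    totient is kept at the full modulus, so that j enters only through a power of p and the
    binomial. *)
Lemma kernel_count_formula p s d m j : prime p -> (j < s.+1)%N ->
  (kernel_count 'Z_(p ^ s.+1) (d + m) m (p ^ j)%N)%:R =
  (\prod_(d.+1 <= u < (d + m).+1) (phi u (p ^ s.+1))%:R)
  * (p%:R ^+ s.+1) ^+ 'C(m, 2) * p%:R ^- (j * (d + m))
  * gauss_binom p (m + j - 1) j :> rat.
Proof.
move=> p_pr; have p_gt1 := prime_gt1 p_pr.
have N_gt1 : (1 < p ^ s.+1)%N by rewrite -(exp1n s.+1) ltn_exp2r.
have p0 : p%:R != 0 :> rat by rewrite pnatr_eq0 -lt0n ltnW.
have cardR : #|'Z_(p ^ s.+1)| = (p ^ s.+1)%N by rewrite card_ord Zp_cast.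
elim: m j => [j _ | m IHm].
  rewrite addn0 kernel_count_cols0 big_geq // expr0 !mul1r add0n.
  (* With no columns only kernel size 1 occurs; for positive exponents the binomial vanishes, its
     upper index being one less than the lower. *)
  case: j => [|j]; first by rewrite mul0n gauss_binom0 expr0 invr1 mulr1.
  rewrite subn1 gauss_binom_small mulr0 gtn_eqF //.
  by rewrite -(exp1n j.+1) ltn_exp2r.
have pc c := @card_Zp_mul_prime p s c p_pr.
(* ['C(m.+1, 2)] exceeds ['C(m, 2)] by m, which accounts for the factor |R|^m of the recursion. *)
rewrite addnS big_nat_recr ?ltnS ?leq_addr //= binS bin1 exprD.
elim=> [_ | j IHj ltj].
  rewrite expn0 (kernel_count_rec1 p_gt1 pc) card_unimodular_Zp // cardR.
  have := IHm 0%N isT; rewrite expn0 !natrM => ->.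
  rewrite !gauss_binom0 !mul0n !expr0 invr1 !mulr1 !natrX.
  by ring.
have := congr1 (fun k => k%:R : rat) (@kernel_count_recM _ _ _ p_gt1 pc (d + m) m (p ^ j) _).
rewrite -expnS cardR ltn_exp2l // ltj => /(_ isT).
rewrite natrD !natrM IHj ?(ltnW ltj) // IHm // card_unimodular_Zp // !natrX.
have -> : (m + j.+1 - 1 = m + j)%N by rewrite addnS subn1.
have -> : (m.+1 + j - 1 = m + j)%N by rewrite addSn subn1.
have -> : (m.+1 + j.+1 - 1 = (m + j).+1)%N by rewrite addSn addnS subn1.
rewrite gauss_binom_pascal //.
set g1 := gauss_binom _ _ _; set g2 := gauss_binom _ _ _ => recE.
have pn0 : p%:R ^+ (d + m).+1 != 0 :> rat by rewrite expf_neq0.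
apply: (mulfI pn0); rewrite recE.
set y := p%:R ^+ (d + m).+1 in pn0 *.
(* Brings the powers of p from the two induction hypotheses to a common form; the remaining p^(j+1)
   is the weight in Pascal's rule. *)
have -> : p%:R ^+ (j * (d + m).+1) = p%:R ^+ j.+1 * p%:R ^+ (j.+1 * (d + m)) / y :> rat.
  by rewrite -exprD -mulnS mulSn exprD mulrC mulKf.
rewrite [(j.+1 * (d + m).+1)%N]mulnS exprD.
by field; rewrite pn0 !expf_neq0.
Qed.

Theorem theorem4p6 (p n m s j : nat) (hp : prime p)
    (hm : (1 <= m)%N) (hmn : (m <= n)%N) (hjs : (j < s)%N) :
  (E n m (p ^ s)%N (p ^ j)%N)%:R =
    (\prod_(n - m + 2 <= u < n.+1) (phi u (p ^ s)%N)%:R)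
    * (phi (n - m + 1)%N (p ^ (s - j))%N)%:R
    * (p%:R : rat) ^ ((s * (m * (m - 1) %/ 2))%N%:Z - (j * (m - 1))%N%:Z)
    * gauss_binom p (m + j - 1)%N j :> rat.
Proof.
case: s hjs => // s hjs; case: m hm hmn => // m _ hmn.
have p0 : p%:R != 0 :> rat by rewrite pnatr_eq0 -lt0n prime_gt0.
set d := (n - m.+1)%N; have -> : n = (d + m.+1)%N by rewrite subnK.
(* [E] unfolds to [kernel_count]. The factor u = d+1 is split off, since phi_u(p^s) = p^(j u)
   phi_u(p^(s-j)); this power cancels part of p^(-j n) and leaves the exponent -j(n-u), where n-u is
   the number of columns minus one. *)
rewrite [LHS](kernel_count_formula _ _ hp hjs) big_ltn ?addnS ?ltnS ?leq_addr //.
rewrite addn0; congr (_ * _).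
rewrite bin2 -divn2 subn1 /= expfzDr // -invr_expz -!exprnP.
have -> : (s.+1 - j)%N = (s - j).+1 by rewrite subSn.
rewrite !phi_natr //.
have -> : (s.+1 * d.+1 = (s - j).+1 * d.+1 + j * d.+1)%N.
  by rewrite -mulnDl addSn subnK.
rewrite -exprM [(j * (d + m).+1)%N](_ : _ = (j * d.+1 + j * m)%N).
  by rewrite !exprD; field; rewrite !expf_neq0.
by rewrite -mulnDr addSn.
Qed.
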